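(* Let $(B_j^k)_{1\le k\le j}$ be the unique family of polynomials in $\mathbb{Z}[q]$ satisfying $B_j^1=1$ for $j\ge1$, $B_j^j=(1-q^2)\cdots(1-q^j)$ for $j\ge 2$, and $B_j^k=B_{j-1}^k+(1-q^j)B_{j-1}^{k-1}-B_{j-2}^{k-1}$ for $2\le k\le j-1$. Then the Poincaré polynomials $a_n=a_n(q)$ of the sets of fully commutative elements of the Coxeter groups $W(A_n)$ satisfy, for every $n\ge 1$, $$q^n a_{n-1}=q+q^2+\cdots+q^n-\sum_{k=2}^{n}q^{n-k+1}B_n^k\,a_{n-k}.$$
   Context: Superscripts in $B_j^k$ are indices, not exponents. For a positive integer $n$, $W(A_n)$ is the Coxeter group with generators $\sigma_1,\dots,\sigma_n$ and relations $\sigma_i^2=1$, $\sigma_i\sigma_{i+1}\sigma_i=\sigma_{i+1}\sigma_i\sigma_{i+1}$ for $1\le i\le n-1$, and $\sigma_i\sigma_j=\sigma_j\sigma_i$ for $|i-j|\ge 2$; $W(A_0)=1$. The length $l(w)$ is the minimal number of generators in an expression of $w$; expressions of this length are called reduced. An element is fully commutative if any of its reduced expressions can be obtained from any other by applying only commutation relations $\sigma_i\sigma_j=\sigma_j\sigma_i$, $|i-j|\ge2$; $W^c(A_n)$ is the set of fully commutative elements of $W(A_n)$, and $a_n=\sum_{w\in W^c(A_n)}q^{l(w)}$, with $a_0=1$. *)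

(* Defs.v *)
From HB Require Import structures.
From mathcomp Require Import all_boot all_order all_algebra all_fingroup.
From mathcomp Require Import generic_quotient.
From mathcomp Require Import boolp classical_sets fsbigop.

Set Implicit Arguments.
Unset Strict Implicit.
Unset Printing Implicit Defensive.

Import GRing.Theory.

Inductive congr (T : Type) (R : seq T -> seq T -> Prop) : seq T -> seq T -> Prop :=
| congr_step u v s t : R s t -> congr R (u ++ s ++ v) (u ++ t ++ v)
| congr_refl s : congr R s s
| congr_sym s t : congr R s t -> congr R t s
| congr_trans s t r : congr R s t -> congr R t r -> congr R s r.

Lemma congr_ctx (T : Type) (R : seq T -> seq T -> Prop) u v s t :
  congr R s t -> congr R (u ++ s ++ v) (u ++ t ++ v).
Proof.
elim=> {s t} [u' v' s t Rst|s|s t _ IH|s t r _ IH1 _ IH2].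
- have := congr_step (u ++ u') (v' ++ v) Rst.
  by rewrite -!catA.
- exact: congr_refl.
- exact: congr_sym.
- exact: congr_trans IH1 IH2.
Qed.

Lemma congr_cat (T : Type) (R : seq T -> seq T -> Prop) s s' t t' :
  congr R s s' -> congr R t t' -> congr R (s ++ t) (s' ++ t').
Proof.
move=> ss' tt'; apply: (@congr_trans _ _ _ (s' ++ t)).
  exact: (congr_ctx [::] t ss').
by have := congr_ctx s' [::] tt'; rewrite !cats0.
Qed.

(* The letter i : 'I_n stands for the generator sigma_(i+1). *)
Inductive comm_rel (n : nat) : seq 'I_n -> seq 'I_n -> Prop :=
| comm_rel_far (i j : 'I_n) :
    (i + 2 <= j)%N || (j + 2 <= i)%N -> comm_rel [:: i; j] [:: j; i].

Inductive coxA_rel (n : nat) : seq 'I_n -> seq 'I_n -> Prop :=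
| coxA_rel_sq (i : 'I_n) : coxA_rel [:: i; i] [::]
| coxA_rel_braid (i j : 'I_n) :
    j = i.+1 :> nat -> coxA_rel [:: i; j; i] [:: j; i; j]
| coxA_rel_comm (s t : seq 'I_n) : comm_rel s t -> coxA_rel s t.

Definition coxA_eqb (n : nat) : rel (seq 'I_n) :=
  fun s t => `[< congr (@coxA_rel n) s t >].

Lemma coxA_eqb_refl n : reflexive (@coxA_eqb n).
Proof. by move=> s; apply/asboolP; exact: congr_refl. Qed.

Lemma coxA_eqb_sym n : symmetric (@coxA_eqb n).
Proof. by move=> s t; apply/asboolP/asboolP; exact: congr_sym. Qed.

Lemma coxA_eqb_trans n : transitive (@coxA_eqb n).
Proof.
by move=> t s r /asboolP st /asboolP tr; apply/asboolP; exact: congr_trans st tr.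
Qed.

Definition coxA_equiv (n : nat) : equiv_rel (seq 'I_n) :=
  EquivRel (@coxA_eqb n) (@coxA_eqb_refl n) (@coxA_eqb_sym n) (@coxA_eqb_trans n).

Local Open Scope quotient_scope.

(* W(A_n): the monoid presented by the generators and relations, which is also
   the group they present since the generators are involutions. *)
Definition coxA (n : nat) : Type := {eq_quot (coxA_equiv n)}.

HB.instance Definition _ n := Choice.on (coxA n).

Section CoxAGroup.
Variable n : nat.
Implicit Types (x y z : coxA n) (s t : seq 'I_n).

Definition coxA_class s : coxA n := \pi_{eq_quot (coxA_equiv n)} s.

Definition coxA_word x : seq 'I_n := repr (x : {eq_quot (coxA_equiv n)}).

Lemma coxA_wordK : cancel coxA_word coxA_class.
Proof. by move=> x; rewrite /coxA_class /coxA_word reprK. Qed.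

Lemma coxA_classP s t : coxA_class s = coxA_class t <-> congr (@coxA_rel n) s t.
Proof. by split=> [/eqquotP/asboolP|st]; last by apply/eqquotP/asboolP. Qed.

Lemma coxA_classK s : congr (@coxA_rel n) (coxA_word (coxA_class s)) s.
Proof. by apply/coxA_classP; rewrite coxA_wordK. Qed.

Definition coxA_one : coxA n := coxA_class [::].

Definition coxA_mul x y : coxA n := coxA_class (coxA_word x ++ coxA_word y).

Definition coxA_inv x : coxA n := coxA_class (rev (coxA_word x)).

Lemma coxA_classM s t :
  coxA_mul (coxA_class s) (coxA_class t) = coxA_class (s ++ t).
Proof. by apply/coxA_classP/congr_cat; exact: coxA_classK. Qed.

Lemma coxA_mulA : associative coxA_mul.
Proof.
move=> x y z; rewrite -[x]coxA_wordK -[y]coxA_wordK -[z]coxA_wordK.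
by rewrite !coxA_classM catA.
Qed.

Lemma coxA_mul1 : left_id coxA_one coxA_mul.
Proof. by move=> x; rewrite -[x]coxA_wordK coxA_classM. Qed.

Lemma coxA_1mul : right_id coxA_one coxA_mul.
Proof. by move=> x; rewrite -[x]coxA_wordK coxA_classM cats0. Qed.

Lemma congr_rev_cat s : congr (@coxA_rel n) (rev s ++ s) [::].
Proof.
elim: s => [|i s IH]; first exact: congr_refl.
rewrite rev_cons -cats1 -catA; apply: congr_trans IH.
exact: (congr_step (rev s) s (coxA_rel_sq i)).
Qed.

Lemma coxA_mulV : left_inverse coxA_one coxA_inv coxA_mul.
Proof.
move=> x; rewrite -{2}[x]coxA_wordK coxA_classM.
by apply/coxA_classP/congr_rev_cat.
Qed.

Lemma coxA_Vmul : right_inverse coxA_one coxA_inv coxA_mul.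
Proof.
move=> x; rewrite -{1}[x]coxA_wordK coxA_classM; apply/coxA_classP.
by have := congr_rev_cat (rev (coxA_word x)); rewrite revK.
Qed.

HB.instance Definition _ := isGroup.Build (coxA n)
  coxA_mulA coxA_mul1 coxA_1mul coxA_mulV coxA_Vmul.

Definition sigma (i : 'I_n) : coxA n := coxA_class [:: i].

Local Open Scope group_scope.

Definition expression_of s x : Prop := \prod_(i <- s) sigma i = x.

Lemma prod_sigma s : \prod_(i <- s) sigma i = coxA_class s.
Proof.
elim: s => [|i s IH]; first by rewrite big_nil.
by rewrite big_cons IH; exact: coxA_classM.
Qed.

Lemma ex_expression x :
  exists m, `[< exists2 s, expression_of s x & size s = m >].
Proof.
exists (size (coxA_word x)); apply/asboolP; exists (coxA_word x) => //.
by rewrite /expression_of prod_sigma coxA_wordK.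
Qed.

Definition coxA_length x : nat := ex_minn (ex_expression x).

Definition reduced_expression_of s x : Prop :=
  expression_of s x /\ size s = coxA_length x.

Definition fully_commutative x : Prop :=
  forall s t, reduced_expression_of s x -> reduced_expression_of t x ->
  congr (@comm_rel n) s t.

End CoxAGroup.

Local Open Scope ring_scope.

(* The polynomial a_n; the indeterminate q is 'X.  The sum has finite support
   because W(A_n) is finite (a sum of infinite support would be 0). *)
Definition poincare_fc (n : nat) : {poly int} :=
  \sum_(w \in [set x : coxA n | fully_commutative x]%classic)
    ('X^(coxA_length w) : {poly int}).

(* B j k is B_j^k; only the values with 1 <= k <= j are meaningful. *)
Definition B_family (B : nat -> nat -> {poly int}) : Prop :=
  [/\ forall j, (1 <= j)%N -> B j 1%N = 1,
      forall j, (2 <= j)%N -> B j j = \prod_(2 <= i < j.+1) (1 - 'X^i)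
    & forall j k, (2 <= k)%N -> (k <= j - 1)%N ->
        B j k = B (j - 1)%N k + (1 - 'X^j) * B (j - 1)%N (k - 1)%N
                - B (j - 2)%N (k - 1)%N].

(* Main.v *)
Require Import Defs.
From mathcomp Require Import all_boot all_order all_algebra.
From mathcomp Require Import zify ring.
From mathcomp Require Import boolp classical_sets functions fsbigop.

(** Fully commutative elements of W(A_n) have a normal form: a product of
    descending runs s_i s_(i-1) ... s_j in which both the tops i and the bottoms
    j increase strictly from left to right.

    Every word is equivalent, under commutations alone, either to a normal form
    or to a word with a factor a a, a (a+1) a or (a+1) a (a+1)
    ([word_nf_or_contractible]); in a reduced word of a fully commutative element
    the second case cannot happen.  Conversely, let W(A_n) act on the integers
    and let E be the sum over y of the excedances max(w(y) - y, 0).  A letter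
    raises E by at most 1, so E is at most the length of any word for w; and a
    factor a a or a (a+1) a acts by the identity or a transposition (a, a+2),
    raising E by at most 0 or 2 for 2 or 3 letters, so E is strictly smaller
    than the length of any word that contains one ([total_exc_contractible]).
    In a normal form the run from i down to j creates exactly one excedance,
    j |-> i+1, so that E equals the length ([total_exc_nf]).  Hence normal forms
    are reduced, all reduced words of their elements fall in the first case, and
    the excedances recover the normal form ([exc_nf_inj]).  Thus a_n is the sum
    of q^(length) over the normal forms.

    Let D_c(m) be that sum over the normal forms with tops < m and bottoms < c
    (letters numbered from 0), so a_m = D_m(m) and D_0(m) = 1.  Splitting
    according to whether the last bottom is c gives
      D_(c+1)(m) = D_c(m) + sum_(c <= i < m) q^(i-c+1) D_c(i),
    and with it the recurrence for the B_j^k yields, by induction on j,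
      sum_(1 <= k <= j) B_j^k q^(r+j-k+1) a_(r+j-k)
        = q^(r+1) sum_(0 <= i < j) q^i D_r(r+i)
    ([triangle_nf_poly]).  The theorem is the case r = 0, j = n. *)

Set Implicit Arguments.
Unset Strict Implicit.
Unset Printing Implicit Defensive.

(** * Words and commutations *)

(** Far commutation on words over nat: working with natural numbers keeps the
    arithmetic of letters out of the ordinal types; [comm_ord_word] transfers
    the results to words over 'I_n. *)
Inductive far_rel : seq nat -> seq nat -> Prop :=
| far_rel_intro (i j : nat) :
    (i + 2 <= j) || (j + 2 <= i) -> far_rel [:: i; j] [:: j; i].

Lemma congr_sub_perm_eq (T : eqType) (R : seq T -> seq T -> Prop) s t :
  (forall s t, R s t -> perm_eq s t) -> congr R s t -> perm_eq s t.
Proof.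
move=> RP; elim=> {s t} [u v s t /RP st|s|s t _|s t r _ st _ tr] //.
- by rewrite perm_cat2l perm_cat2r.
- by rewrite perm_sym.
- exact: perm_trans st tr.
Qed.

Lemma far_perm_eq s t : congr far_rel s t -> perm_eq s t.
Proof.
by apply: congr_sub_perm_eq => _ _ [i j _]; rewrite (perm_catC [:: i] [:: j]).
Qed.

Lemma comm_perm_eq n (s t : seq 'I_n) : congr (@comm_rel n) s t -> perm_eq s t.
Proof.
by apply: congr_sub_perm_eq => _ _ [i j _]; rewrite (perm_catC [:: i] [:: j]).
Qed.

Lemma far_catl u s t : congr far_rel s t -> congr far_rel (u ++ s) (u ++ t).
Proof. by move=> st; apply: congr_cat st; exact: congr_refl. Qed.

Lemma far_catr u s t : congr far_rel s t -> congr far_rel (s ++ u) (t ++ u).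
Proof. by move=> st; apply: (congr_cat st); exact: congr_refl. Qed.

Lemma far_letter_word a s :
  all (fun b => (a + 2 <= b) || (b + 2 <= a)) s ->
  congr far_rel (a :: s) (rcons s a).
Proof.
elim: s => [_|b s IH /= /andP[ab /IH as_]]; first exact: congr_refl.
apply: congr_trans (congr_step [::] s (far_rel_intro ab)) _ => /=.
exact: (far_catl [:: b]).
Qed.

(** * The action on integers and excedances *)

Definition swap i y := if y == i then i.+1 else if y == i.+1 then i else y.

Definition act (s : seq nat) y := foldr swap y s.

Lemma act_cat s t y : act (s ++ t) y = act s (act t y).
Proof. by rewrite /act foldr_cat. Qed.

Lemma swapK i : involutive (swap i).
Proof. by rewrite /swap => y; do !case: eqP; lia. Qed.

Lemma act_inj s : injective (act s).
Proof. by elim: s => // i s IH y z /(can_inj (swapK i))/IH. Qed.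

Lemma act_congr (T : Type) (f : T -> nat) (R : seq T -> seq T -> Prop) s t :
  (forall s t, R s t -> act (map f s) =1 act (map f t)) ->
  congr R s t -> act (map f s) =1 act (map f t).
Proof.
move=> RP; elim=> {s t} [u v s t /RP st|s|s t _ st|s t r _ st _ tr] y //.
- by rewrite !map_cat !act_cat st.
- by rewrite st tr.
Qed.

Lemma act_far s t : congr far_rel s t -> act s =1 act t.
Proof.
move=> /(@act_congr _ id _ s t); rewrite !map_id; apply=> _ _ [i j ij] y /=.
by rewrite /swap; do !case: eqP; lia.
Qed.

Lemma act_coxA n (s t : seq 'I_n) :
  congr (@coxA_rel n) s t -> act (map val s) =1 act (map val t).
Proof.
apply: act_congr => _ _ [i|i j ij|_ _ [i j ij]] y /=.
- exact: swapK.
- by rewrite /swap ij; do !case: eqP; lia.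
- by rewrite /swap; do !case: eqP; lia.
Qed.

Definition exc s y := act s y - y.

Definition total_exc N s := \sum_(y < N) exc s y.

Lemma exc_nil y : exc [::] y = 0.
Proof. exact: subnn. Qed.

Lemma total_exc_nil N : total_exc N [::] = 0.
Proof. by rewrite /total_exc big1 // => y _; rewrite exc_nil. Qed.

(** Only the point that s sends to i can gain from applying u afterwards, because
    act s is injective. *)
Lemma total_exc_raise N u s i k :
  (forall y, act u y <= y + k * (y == i)) ->
  total_exc N (u ++ s) <= total_exc N s + k.
Proof.
move=> up; suff le1 : \sum_(y < N) (act s y == i) <= 1.
  apply: leq_trans (_ : \sum_(y < N) (exc s y + k * (act s y == i)) <= _).
    by apply: leq_sum => y _; rewrite /exc act_cat; have := up (act s y); lia.
  by rewrite big_split -big_distrr leq_add2l -[leqRHS]muln1 leq_mul2l le1 orbT.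
rewrite -big_mkcond sum1_card; apply/card_le1_eqP => y z.
by rewrite !unfold_in => /eqP <- /eqP/act_inj/val_inj.
Qed.

Lemma total_exc_cat N u s : total_exc N (u ++ s) <= total_exc N s + size u.
Proof.
elim: u => [|i u IH] /=; first by rewrite addn0.
apply: leq_trans (@total_exc_raise N [:: i] (u ++ s) i 1 _) _ => [y|].
  by rewrite /= /swap; do !case: eqP; lia.
by rewrite addn1 addnS ltnS.
Qed.

(** The factors that a reduced word of a fully commutative element avoids. *)
Variant contractible : seq nat -> Prop :=
| contractible_sq u v i : contractible (u ++ [:: i; i] ++ v)
| contractible_up u v i : contractible (u ++ [:: i; i.+1; i] ++ v)
| contractible_down u v i : contractible (u ++ [:: i.+1; i; i.+1] ++ v).

(** The factor i i moves nothing, and i (i+1) i exchanges i and i+2: it raises a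
    single point, by 2, while contributing 3 letters. *)
Lemma total_exc_contractible N s : contractible s -> total_exc N s < size s.
Proof.
have le0 v : total_exc N v <= size v.
  by have := total_exc_cat N v [::]; rewrite cats0 total_exc_nil.
suff lt_mid w i k u v : k < size w -> (forall y, act w y <= y + k * (y == i)) ->
    total_exc N (u ++ w ++ v) < size (u ++ w ++ v).
  case=> u v i.
  - by apply: (lt_mid _ i 0) => // y; rewrite /= swapK addn0.
  - by apply: (lt_mid _ i 2) => // y; rewrite /= /swap; do !case: eqP; lia.
  - by apply: (lt_mid _ i 2) => // y; rewrite /= /swap; do !case: eqP; lia.
move=> lt_k up; apply: leq_ltn_trans (total_exc_cat N u (w ++ v)) _.
have := total_exc_raise N v up; have := le0 v; rewrite !size_cat; lia.
Qed.

(** * Normal forms *)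

(** The descending run i, i-1, ..., j. *)
Definition block i j := rev (iota j (i.+1 - j)).

(** Concatenations of blocks i, ..., j with strictly increasing tops i < m and
    strictly increasing bottoms j < c.  The recursion on c singles out the words
    whose last block ends in c', which is the recurrence needed for the
    generating polynomials. *)
Fixpoint nf c m : seq (seq nat) :=
  if c is c'.+1 then
    nf c' m ++ [seq z ++ block i c' | i <- iota c' (m - c'), z <- nf c' i]
  else [:: [::]].

Variant nf_spec c m : seq nat -> Prop :=
| nf_spec_nil : nf_spec c m [::]
| nf_spec_block i j z : j < c -> j <= i < m -> z \in nf j i ->
    nf_spec c m (z ++ block i j).

Lemma nfP c m s : reflect (nf_spec c m s) (s \in nf c m).
Proof.
apply: (iffP idP) => [|[|i j z lt_jc]].
- elim: c => [|c IH /=]; first by rewrite inE => /eqP ->; left.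
  rewrite mem_cat => /orP[/IH[|i j z jc im zin]|]; first by left.
    by right => //; exact: ltnW.
  case/allpairsPdep=> i [z [im zin ->]]; right => //.
  by move: im; rewrite mem_iota; lia.
- by elim: c => //= c IH; rewrite mem_cat IH.
elim: c lt_jc => //= c IH; rewrite ltnS mem_cat leq_eqVlt.
case: eqP => [-> _|_ /= /IH lt_j] im zin; last by rewrite lt_j.
apply/orP; right; apply/allpairsPdep; exists i, z; split=> //.
by rewrite mem_iota; lia.
Qed.

Lemma nf_ind (P : nat -> nat -> seq nat -> Prop) :
  (forall c m, P c m [::]) ->
  (forall c m i j z, j < c -> j <= i < m -> z \in nf j i -> P j i z ->
    P c m (z ++ block i j)) ->
  forall c m s, s \in nf c m -> P c m s.
Proof.
move=> Pnil Pblock c; elim/ltn_ind: c => c IH m s /nfP[|i j z jc ijm zin] //.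
by apply: Pblock => //; exact: IH.
Qed.

Lemma block_split i j a : j <= a < i ->
  block i j = block i a.+1 ++ block a j.
Proof.
move=> jai; rewrite /block -rev_cat; congr rev.
have -> : i.+1 - j = (a.+1 - j) + (i.+1 - a.+1) by lia.
by rewrite iotaD; congr (_ ++ iota _ _); lia.
Qed.

Lemma block_last i j : j <= i -> block i j = rcons (block i j.+1) j.
Proof. by move=> ji; rewrite /block subSn //= rev_cons subSS. Qed.

Lemma size_block i j : size (block i j) = i.+1 - j.
Proof. by rewrite size_rev size_iota. Qed.

Lemma mem_block i j a : (a \in block i j) = (j <= a <= i).
Proof. by rewrite mem_rev mem_iota; lia. Qed.

Lemma nf_letters c m s : s \in nf c m -> all (fun a => a < m) s.
Proof.
move=> sin; elim/nf_ind: c m s / sin => // c m i j z _ ijm _ IH.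
rewrite all_cat; apply/andP; split.
  by apply: sub_all IH => a /=; lia.
by apply/allP => a; rewrite mem_block; lia.
Qed.

Lemma act_block i j y : j <= i ->
  act (block i j) y = if y == j then i.+1 else if j < y <= i.+1 then y.-1 else y.
Proof.
elim: i => [|i IH].
  rewrite leqn0 => /eqP->; rewrite /block /= /swap; do !case: ifP; lia.
rewrite leq_eqVlt => /orP[/eqP ->|ji].
  by rewrite /block subSnn /= /swap; do !case: ifP; lia.
rewrite (block_split (a := i)); last by rewrite -ltnS ji /=.
rewrite {1}/block subSnn /= IH // /swap; do !case: ifP; lia.
Qed.

Lemma act_large s m y : all (fun a => a < m) s -> m < y -> act s y = y.
Proof.
elim: s => //= a s IH /andP[am /IH sy] my.
by rewrite sy // /swap; do !case: ifP; lia.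
Qed.

(** A point above j stays or moves down one step, to a place at or above j, where
    z has no excedance; the point j goes to i+1, beyond the letters of z. *)
Lemma exc_nf_block i j z y : j <= i -> z \in nf j i ->
    (forall x, j <= x -> exc z x = 0) ->
  exc (z ++ block i j) y =
    if y < j then exc z y else if y == j then i.+1 - j else 0.
Proof.
move=> ji /nf_letters zlt z0; rewrite /exc act_cat act_block //.
case: (ltngtP y j) => yj /=.
- by [].
- have := z0 y.-1; have := z0 y; rewrite /exc.
  case: ifP; lia.
- by rewrite yj (act_large zlt).
Qed.

Lemma exc_nf0 c m s y : s \in nf c m -> c <= y -> exc s y = 0.
Proof.
move=> sin; elim/nf_ind: c m s / sin y => [c m y _|c m i j z jc ijm zin IH y cy].
  exact: exc_nil.
rewrite exc_nf_block //; last by case/andP: ijm.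
by do !case: ifP; lia.
Qed.

Lemma exc_nfE c m i j z y : j < c -> j <= i < m -> z \in nf j i ->
  exc (z ++ block i j) y =
    if y < j then exc z y else if y == j then i.+1 - j else 0.
Proof.
move=> jc /andP[ji im] zin; apply: exc_nf_block => // x; exact: exc_nf0 zin.
Qed.

(** The last block has length i + 1 - j, and adds just this excedance, at j. *)
Lemma total_exc_nf c m s N : s \in nf c m -> c <= N -> total_exc N s = size s.
Proof.
move=> sin; elim/nf_ind: c m s / sin N => [c m N _|c m i j z jc ijm zin IH N cN].
  exact: total_exc_nil.
rewrite size_cat size_block -(IH N); last by lia.
have jN : j < N by lia.
rewrite /total_exc (bigD1 (Ordinal jN)) //= [in RHS](bigD1 (Ordinal jN)) //=.
rewrite (exc_nfE _ jc ijm zin) ltnn eqxx (exc_nf0 zin (leqnn j)) add0n addnC.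
congr (_ + _); apply: eq_bigr => y; rewrite -val_eqE /= => yj.
rewrite (exc_nfE _ jc ijm zin) (negbTE yj); case: ltnP => // jy.
by rewrite (exc_nf0 zin jy).
Qed.

(** The largest excedance point is the last bottom j and its image is i + 1, so
    the last block can be read off; below j the excedances are those of the
    shorter normal form. *)
Lemma exc_nf_inj c m c' m' s t : s \in nf c m -> t \in nf c' m' ->
  exc s =1 exc t -> s = t.
Proof.
move=> sin; elim/nf_ind: c m s / sin c' m' t.
  move=> c m c' m' _ /nfP[|i j z jc ijm zin] // /(_ j).
  by rewrite (exc_nfE _ jc ijm zin) ltnn eqxx exc_nil; lia.
move=> c m i j z jc ijm zin IH c' m' _ /nfP[|i' j' z' jc' ijm' zin'].
  by move=> /(_ j); rewrite (exc_nfE _ jc ijm zin) ltnn eqxx exc_nil; lia.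
move=> eq_exc.
have eq_y y : (if y < j then exc z y else if y == j then i.+1 - j else 0) =
    if y < j' then exc z' y else if y == j' then i'.+1 - j' else 0.
  by rewrite -(exc_nfE _ jc ijm zin) -(exc_nfE _ jc' ijm' zin').
have ejj : j = j'.
  have := eq_y j; have := eq_y j'; rewrite !ltnn !eqxx.
  by case: (ltngtP j j'); lia.
rewrite -ejj in ijm' zin' eq_y *.
have eii : i = i' by have := eq_y j; rewrite ltnn eqxx; lia.
rewrite -eii in zin' *; congr (_ ++ _); apply: (IH _ _ _ zin') => y.
have := eq_y y; case: ltnP => // jy _.
by rewrite (exc_nf0 zin jy) (exc_nf0 zin' jy).
Qed.

Lemma nf_uniq c m : uniq (nf c m).
Proof.
elim: c m => // c IH m /=; rewrite cat_uniq IH /=; apply/andP; split.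
  apply/hasPn => _ /allpairsPdep[i [z [im zin ->]]]; apply/negP => /exc_nf0.
  move: im; rewrite mem_iota => im /(_ _ (leqnn c)).
  by rewrite (@exc_nfE c.+1 m) // ?ltnn ?eqxx; lia.
apply: allpairs_uniq_dep => [|i _|]; [exact: iota_uniq|exact: IH|].
move=> _ _ /allpairsPdep[i [z [im zin ->]]] /allpairsPdep[i' [z' [im' zin' ->]]].
move: im im'; rewrite !mem_iota /= => im im' eq_s.
have eii : i = i'.
  have : exc (z ++ block i c) c = exc (z' ++ block i' c) c by rewrite eq_s.
  by rewrite !(@exc_nfE c.+1 m) // ?ltnn ?eqxx; lia.
rewrite /= -eii in eq_s *; congr Tagged; apply/eqP.
move: (congr1 size eq_s); rewrite !size_cat => /addIn size_z.
by move/eqP: eq_s; rewrite eqseq_cat // => /andP[].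
Qed.

Lemma block_first i j : j <= i -> block i j = i :: rev (iota j (i - j)).
Proof.
by move=> ji; rewrite /block subSn // -addn1 iotaD rev_cat /= subnKC.
Qed.

Lemma contractible_cat u s v : contractible s -> contractible (u ++ s ++ v).
Proof.
by case=> u' v' i; rewrite -!catA catA; constructor.
Qed.

(** Compare a with the last block i, ..., j.  Above i it starts a new block;
    from j + 1 to i it commutes back to make a braid a (a-1) a; at j it repeats
    a letter; below j - 1 it commutes through the block into the shorter normal
    form, whose bottoms remain < j; and at j - 1 it prolongs the block, unless the
    previous block also ends in j - 1, which makes a braid. *)
Lemma nf_rcons c m s a : s \in nf c m -> a < m ->
  (exists2 t, t \in nf (maxn c a.+1) m & congr far_rel (rcons s a) t) \/
  (exists2 t, contractible t & congr far_rel (rcons s a) t).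
Proof.
have single b : block b b = [:: b] by rewrite /block subSnn.
move=> sin; elim/nf_ind: c m s / sin a => [c m a am|c m i j z jc ijm zin IH a am].
  left; exists [:: a]; last exact: congr_refl.
  rewrite -single -[block a a]cat0s; apply/nfP; right; rewrite ?leqnn ?leq_maxr //.
  by apply/nfP; left.
have /andP[ji im] := ijm.
case: (ltnP i a) => [ia|ai].
  left; exists (rcons (z ++ block i j) a); last exact: congr_refl.
  rewrite -cats1 -single; apply/nfP; right; rewrite ?leqnn ?leq_maxr //.
  by apply/nfP; right; rewrite ?ji ?ia //; lia.
case: (ltngtP j a) => [ja|aj|<-].
- right; case: a => // a in am ai ja *; rewrite ltnS in ja.
  pose w := rev (iota j (a - j)).
  exists ((z ++ block i a.+2) ++ [:: a.+1; a; a.+1] ++ w).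
    exact: contractible_down.
  rewrite (block_split (a := a)) ?ja // (block_last ai) (block_first ja) -/w.
  have -> : rcons (z ++ rcons (block i a.+2) a.+1 ++ a :: w) a.+1 =
      (z ++ block i a.+2 ++ [:: a.+1; a]) ++ rcons w a.+1.
    by rewrite -?cats1 -?catA /= -?catA.
  have -> : (z ++ block i a.+2) ++ [:: a.+1; a; a.+1] ++ w =
      (z ++ block i a.+2 ++ [:: a.+1; a]) ++ a.+1 :: w by rewrite -!catA.
  apply/far_catl/congr_sym/far_letter_word/allP => b.
  by rewrite /w mem_rev mem_iota; lia.
- case: (ltnP a.+1 j) => aj1.
    have move_a : congr far_rel (rcons (z ++ block i j) a) (rcons z a ++ block i j).
      rewrite rcons_cat cat_rcons; apply/far_catl/congr_sym/far_letter_word/allP.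
      by move=> b; rewrite mem_block; lia.
    case: (IH a) => [|[t tin zt]|[t tin zt]]; first lia.
      left; exists (t ++ block i j); last first.
        exact: congr_trans move_a (far_catr _ zt).
      apply/nfP; right=> //; first by lia.
      by move: tin; rewrite (maxn_idPl _) // ltnW.
    right; exists (t ++ block i j); last first.
      exact: congr_trans move_a (far_catr _ zt).
    exact: (contractible_cat [::]).
  have ej : j = a.+1 by lia.
  rewrite {}ej {IH aj aj1} in jc ijm zin ji *.
  case/nfP: zin => [|i' j' z' ja iji zin'].
    left; exists (block i a); last by rewrite [block i a]block_last //; exact: congr_refl.
    rewrite -[block i a]cat0s; apply/nfP; right; rewrite ?leq_max ?leqnn ?orbT //.
      by rewrite ltnW.
    by apply/nfP; left.
  rewrite ltnS leq_eqVlt in ja; case/predU1P: ja => [ej'|ja].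
    rewrite {j'}ej' in iji zin' *; right.
    exists ((z' ++ block i' a.+1 ++ block i a.+2) ++ [:: a; a.+1; a] ++ [::]).
      exact: contractible_up.
    rewrite (block_last (i := i') (j := a)); last by case/andP: iji.
    rewrite (block_last (i := i) (j := a.+1)) //.
    set b1 := block _ _; set b2 := block _ _.
    have -> : rcons ((z' ++ rcons b1 a) ++ rcons b2 a.+1) a =
        (z' ++ b1) ++ (a :: b2) ++ [:: a.+1; a].
      by rewrite -?cats1 -?catA /= -?catA.
    have -> : (z' ++ b1 ++ b2) ++ [:: a; a.+1; a] ++ [::] =
        (z' ++ b1) ++ rcons b2 a ++ [:: a.+1; a].
      by rewrite -?cats1 -?catA /= -?catA.
    apply/far_catl/far_catr/far_letter_word/allP => b.
    by rewrite mem_block; lia.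
  left; exists ((z' ++ block i' j') ++ block i a).
    apply/nfP; right; rewrite ?leq_max ?leqnn ?orbT ?(ltnW ji) //.
    by apply/nfP; right.
  by rewrite (block_last (ltnW ji)) rcons_cat; exact: congr_refl.
- right; exists (rcons (z ++ block i j) j); last exact: congr_refl.
  rewrite block_last // -!cats1 -!catA catA.
  exact: (contractible_sq _ [::]).
Qed.

Lemma word_nf_or_contractible n s : all (fun a => a < n) s ->
  (exists2 t, t \in nf n n & congr far_rel s t) \/
  (exists2 t, contractible t & congr far_rel s t).
Proof.
elim/last_ind: s => [_|s a IH].
  by left; exists [::]; [apply/nfP; left|exact: congr_refl].
rewrite all_rcons => /andP[an /IH[]] {IH} [t tP st].
  case: (nf_rcons tP an) => -[t' t'P tt']; [left|right]; exists t' => //.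
  - by rewrite (maxn_idPl an) in t'P.
  - by rewrite -cats1; apply: congr_trans (far_catr _ st) _; rewrite cats1.
  - by rewrite -cats1; apply: congr_trans (far_catr _ st) _; rewrite cats1.
right; exists (t ++ [:: a]); first exact: (contractible_cat [::]).
by rewrite -cats1; exact: far_catr.
Qed.

(** * Normal forms are the fully commutative elements *)

(** Letters i >= n are dropped: this makes the map total for every n, 0 included,
    and still sends a commutation to a commutation or an equality. *)
Definition ord_word n (s : seq nat) : seq 'I_n := pmap insub s.

Lemma val_ord_word n s : all (fun a => a < n) s -> map val (ord_word n s) = s.
Proof.
move=> slt; rewrite /ord_word (pmap_filter (insubK _)); apply/all_filterP.
by apply: sub_all slt => a an /=; rewrite insubT.
Qed.

Lemma ord_wordK n (s : seq 'I_n) : ord_word n (map val s) = s.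
Proof. by apply: (map_pK valK). Qed.

Lemma comm_ord_word n s t :
  congr far_rel s t -> congr (@comm_rel n) (ord_word n s) (ord_word n t).
Proof.
elim=> {s t} [u v _ _ [i j ij]|s|s t _|s t r _ st _ tr].
- rewrite /ord_word !pmap_cat; apply: congr_ctx => /=.
  case: insubP => [j' _ ej|_]; case: insubP => [i' _ ei|_] /=;
    try exact: congr_refl.
  apply: (congr_step [::] [::] (comm_rel_far (i := i') (j := j') _)).
  by rewrite ei ej.
- exact: congr_refl.
- exact: congr_sym.
- exact: congr_trans st tr.
Qed.

Lemma comm_coxA n (s t : seq 'I_n) :
  congr (@comm_rel n) s t -> congr (@coxA_rel n) s t.
Proof.
elim=> {s t} [u v s t st|s|s t _|s t r _ st _ tr].
- exact: (congr_step u v (coxA_rel_comm st)).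
- exact: congr_refl.
- exact: congr_sym.
- exact: congr_trans st tr.
Qed.

Lemma ord_letters n (s : seq 'I_n) : all (fun a => a < n) (map val s).
Proof. by rewrite all_map; apply/allP => i _ /=. Qed.

Lemma expressionP n (s : seq 'I_n) x : expression_of s x <-> coxA_class s = x.
Proof. by rewrite /expression_of prod_sigma. Qed.

Lemma length_le n (s : seq 'I_n) x : coxA_class s = x -> coxA_length x <= size s.
Proof.
move=> sx; rewrite /coxA_length; case: ex_minnP => m _; apply.
by apply/boolp.asboolP; exists s => //; apply/expressionP.
Qed.

Lemma ex_reduced n (x : coxA n) :
  exists2 s, coxA_class s = x & size s = coxA_length x.
Proof.
rewrite /coxA_length; case: ex_minnP => m /boolp.asboolP[s /expressionP sx sm] _.
by exists s.
Qed.

(** Excedances depend only on the group element, and bound from below the size of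
    all its words. *)
Lemma nf_length n s : s \in nf n n ->
  coxA_length (coxA_class (ord_word n s)) = size s.
Proof.
move=> sin; apply/eqP; rewrite eqn_leq; apply/andP; split.
  apply: leq_trans (length_le (erefl _)) _.
  by rewrite -(size_map val) val_ord_word ?(nf_letters sin).
have [t /coxA_classP/act_coxA ts <-] := ex_reduced (coxA_class (ord_word n s)).
rewrite (val_ord_word (nf_letters sin)) in ts.
rewrite -(total_exc_nf sin (leqnn n)) -(size_map val t).
have := total_exc_cat n (map val t) [::]; rewrite cats0 total_exc_nil.
by congr (_ <= _); apply: eq_bigr => y _; rewrite /exc ts.
Qed.

(** A reduced word of this element has as many letters as total excedance, so it
    is not commutation equivalent to a contractible word. *)
Lemma nf_fully_commutative n s : s \in nf n n ->
  fully_commutative (coxA_class (ord_word n s)).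
Proof.
move=> sin.
suff to_s t : reduced_expression_of t (coxA_class (ord_word n s)) ->
    congr (@comm_rel n) t (ord_word n s).
  by move=> t t' /to_s ts /to_s t's; apply: congr_trans ts (congr_sym t's).
case=> /expressionP/coxA_classP/act_coxA ts; rewrite nf_length // => size_t.
rewrite (val_ord_word (nf_letters sin)) in ts.
case: (word_nf_or_contractible (ord_letters t)) => -[r rP tr].
  have := comm_ord_word n tr; rewrite ord_wordK (exc_nf_inj rP sin) // => y.
  by rewrite /exc -(act_far tr) ts.
have := total_exc_contractible n rP.
rewrite -(perm_size (far_perm_eq tr)) size_map size_t -(total_exc_nf sin (leqnn n)).
suff -> : total_exc n r = total_exc n s by rewrite ltnn.
by apply: eq_bigr => y _; rewrite /exc -(act_far tr) ts.
Qed.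

(** Commutations preserve the number of occurrences of each letter, and applying
    a braid relation changes it: a reduced word of x contains no braid up to
    commutations. *)
Lemma fully_commutative_nf n (x : coxA n) : fully_commutative x ->
  exists2 s, s \in nf n n & coxA_class (ord_word n s) = x.
Proof.
move=> xfc; have [s sx s_len] := ex_reduced x.
case: (word_nf_or_contractible (ord_letters s)) => -[t tP st].
  exists t => //; rewrite -sx; apply/coxA_classP/comm_coxA/congr_sym.
  by have := comm_ord_word n st; rewrite ord_wordK.
have tlt : all (fun a => a < n) t.
  by rewrite -(perm_all _ (far_perm_eq st)) ord_letters.
have tx : coxA_class (ord_word n t) = x.
  rewrite -sx; apply/coxA_classP/comm_coxA/congr_sym.
  by have := comm_ord_word n st; rewrite ord_wordK.
have size_t : size t = coxA_length x.
  by rewrite -s_len -(size_map val s) (perm_size (far_perm_eq st)).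
have no_braid u v (i j : 'I_n) :
    congr (@coxA_rel n) (u ++ [:: i; j; i] ++ v) (u ++ [:: j; i; j] ++ v) ->
    i != j -> ~ reduced_expression_of (u ++ [:: i; j; i] ++ v) x.
  move=> /coxA_classP eq_cl ij red1; have [/expressionP cl sz] := red1.
  have red2 : reduced_expression_of (u ++ [:: j; i; j] ++ v) x.
    by split; [apply/expressionP; rewrite -eq_cl|rewrite -sz !size_cat].
  have /comm_perm_eq/permP/(_ (pred1 i)) := xfc _ _ red1 red2.
  by rewrite !count_cat /= eqxx eq_sym (negbTE ij); lia.
have t_red : reduced_expression_of (ord_word n t) x.
  by split; [exact/expressionP|rewrite -(size_map val) val_ord_word].
exfalso; case: tP tlt t_red => u v i; rewrite !all_cat /= => /and3P[_ ilt _].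
- case/andP: ilt => i_n _; rewrite /ord_word !pmap_cat /= insubT /=.
  set u' := pmap _ u; set v' := pmap _ v => -[/expressionP cl sz].
  have : coxA_length x <= size (u' ++ v').
    apply: length_le; rewrite -cl; apply/coxA_classP/congr_sym.
    exact: (congr_step u' v' (coxA_rel_sq _)).
  by rewrite -sz !size_cat /=; lia.
- case/and4P: ilt => i_n i1_n _ _; rewrite /ord_word !pmap_cat /=.
  rewrite !(insubT (fun a => a < n) i_n) !(insubT (fun a => a < n) i1_n) /=.
  apply: no_braid; last by rewrite -val_eqE /= ltn_eqF.
  exact: (congr_step _ _ (coxA_rel_braid _)).
case/and4P: ilt => i1_n i_n _ _; rewrite /ord_word !pmap_cat /=.
rewrite !(insubT (fun a => a < n) i_n) !(insubT (fun a => a < n) i1_n) /=.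
apply: no_braid; last by rewrite -val_eqE /= gtn_eqF.
exact/congr_sym/(congr_step _ _ (coxA_rel_braid _)).
Qed.

(** * The generating polynomials *)

Import GRing.Theory.
Local Open Scope ring_scope.

Definition nf_poly c m : {poly int} := \sum_(s <- nf c m) 'X^(size s).

Lemma poincare_fcE n : poincare_fc n = nf_poly n n.
Proof.
pose h s := coxA_class (ord_word n s).
have h_act s t : s \in nf n n -> t \in nf n n -> h s = h t -> s = t.
  move=> sin tin /coxA_classP/act_coxA.
  rewrite (val_ord_word (nf_letters sin)) (val_ord_word (nf_letters tin)) => st.
  by apply: (exc_nf_inj sin tin) => y; rewrite /exc st.
have fcE : [set x : coxA n | fully_commutative x]%classic =
    [set h s | s in [set` nf n n]]%classic.
  apply/seteqP; split=> [x /fully_commutative_nf[s sin <-]|_ [s sin <-]].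
    by exists s.
  exact: nf_fully_commutative.
rewrite /poincare_fc fcE fsbig_image; last first.
  by move=> s t; rewrite !inE => sin tin; exact: h_act.
rewrite -fsbig_seq ?nf_uniq // /nf_poly big_seq [RHS]big_seq.
by apply: eq_bigr => s sin; rewrite nf_length.
Qed.

Lemma nf_poly0 m : nf_poly 0 m = 1.
Proof. by rewrite /nf_poly big_seq1. Qed.

(** The words counted by the difference end in a block i, ..., c, where i runs
    over c, ..., c + k - 1. *)
Lemma nf_polyS c k :
  nf_poly c.+1 (c + k) =
    nf_poly c (c + k) + 'X * \sum_(i < k) 'X^i * nf_poly c (c + i).
Proof.
rewrite /nf_poly /= big_cat big_allpairs_dep /= addKn; congr (_ + _).
rewrite -[X in iota X]addn0 iotaDl big_map -{1}[k]subn0 -/(index_iota 0 k).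
rewrite big_mkord mulr_sumr; apply: eq_bigr => i _.
rewrite mulrA mulr_sumr; apply: eq_bigr => s _.
rewrite size_cat size_block subSn ?leq_addr // addKn exprD exprS.
by rewrite mulrC.
Qed.

(** The B_j^k extended by 0 to k = 0 and to k > j: with this convention the
    recurrence also produces the boundary values B_j^1 and B_j^j. *)
Fixpoint triangle (j k : nat) : {poly int} :=
  match j, k with
  | (j'.+1 as j1).+1, k'.+1 =>
      triangle j1 k + (1 - 'X^j) * triangle j1 k' - triangle j' k'
  | 1%N, 1%N => 1
  | _, _ => 0
  end.

Arguments triangle : simpl never.

Lemma triangleSS j k :
  triangle j.+2 k.+1 =
    triangle j.+1 k.+1 + (1 - 'X^(j.+2)) * triangle j.+1 k - triangle j k.
Proof. by []. Qed.

Lemma triangle0 j : triangle j 0 = 0.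
Proof. by case: j => [|[]]. Qed.

Lemma triangle_gt j k : (j < k)%N -> triangle j k = 0.
Proof.
elim/ltn_ind: j k => -[|[|j]] IH [|[|k]] // jk; rewrite triangleSS !IH //; try lia.
by rewrite mulr0 addr0 subr0.
Qed.

Lemma triangle_family : B_family triangle.
Proof.
split.
- elim=> [//|[//|j] IH _]; rewrite triangleSS IH //.
  by rewrite !triangle0 mulr0 addr0 subr0.
- case=> [//|[//|j]] _; elim: j => [|j IH].
    by rewrite big_nat1 triangleSS /= mulr1 add0r subr0.
  rewrite big_nat_recr // -IH triangleSS (@triangle_gt j.+2 j.+3) //.
  by rewrite (@triangle_gt j.+1 j.+2) // add0r subr0 mulrC.
- case=> [|[|j]] [|k] //= _ _.
  by rewrite !subn1 subn2.
Qed.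

Lemma B_family_uniq B B' : B_family B -> B_family B' ->
  forall j k, (1 <= k <= j)%N -> B j k = B' j k.
Proof.
move=> [B1 Bjj Brec] [B1' Bjj' Brec'] j; elim/ltn_ind: j => j IH k /andP[k0 kj].
case: (eqVneq k 1%N) => [->|k1]; first by rewrite B1 ?B1' //; lia.
case: (eqVneq k j) => [->|kj']; first by rewrite Bjj ?Bjj' //; lia.
have {}k1 : (2 <= k)%N by lia.
have {}kj : (k <= j - 1)%N by lia.
rewrite Brec // Brec' // !IH //; lia.
Qed.

(** By the recurrence for [triangle], the left-hand sides S_j(r) satisfy
    S_(j+2)(r) = S_(j+1)(r+1) + (1 - q^(j+2)) S_(j+1)(r) - S_j(r+1); [nf_polyS]
    shows that the right-hand sides do as well. *)
Lemma triangle_nf_poly j r :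
  \sum_(1 <= k < j.+1)
    triangle j k * ('X^((r + j - k).+1) * nf_poly (r + j - k) (r + j - k)) =
  'X^(r.+1) * \sum_(i < j) 'X^i * nf_poly r (r + i).
Proof.
pose alpha m : {poly int} := 'X^(m.+1) * nf_poly m m.
(* the upper bound K lets sums for different j be combined termwise *)
have sum_pad i K s : (i <= K)%N ->
    \sum_(1 <= k < i.+1) triangle i k * alpha (s - k)%N =
    \sum_(k < K) triangle i k.+1 * alpha (s - k.+1)%N.
  move=> iK; rewrite big_add1 big_mkord.
  rewrite (big_ord_widen K (fun k => triangle i k.+1 * alpha (s - k.+1)%N) iK).
  rewrite big_mkcond; apply: eq_bigr => k _; case: ltnP => // ik.
  by rewrite triangle_gt ?mul0r.
suff padded K : (j <= K)%N ->
    \sum_(k < K) triangle j k.+1 * alpha (r + j - k.+1)%N =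
    'X^(r.+1) * \sum_(i < j) 'X^i * nf_poly r (r + i).
  by rewrite (sum_pad j j) // padded.
elim/ltn_ind: j r K => -[|[|j]] IH r K jK.
- by rewrite big_ord0 mulr0 big1 // => k _; rewrite mul0r.
- rewrite -sum_pad // big_nat1 big_ord1 mul1r expr0 mul1r addn0.
  by rewrite addn1 subn1.
case: K jK => // K; rewrite ltnS => jK.
have shift m : \sum_(k < K.+1) triangle m k * alpha (r + j.+2 - k.+1)%N =
    \sum_(k < K) triangle m k.+1 * alpha (r + j.+1 - k.+1)%N.
  rewrite big_ord_recl triangle0 mul0r add0r; apply: eq_bigr => k _.
  by rewrite addnS subSS.
under eq_bigr do rewrite triangleSS mulrBl mulrDl -mulrA.
rewrite sumrB big_split /= -mulr_sumr !shift (IH j.+1) //.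
rewrite -addSnnS (IH j.+1) //; last by rewrite ltnW.
rewrite -addSnnS (IH j) //; last by rewrite ltnW.
rewrite [in RHS]big_ord_recr /= big_ord_recr /=.
rewrite addSnnS nf_polyS !exprS.
set D := nf_poly r _; set G := \sum_(i < j.+1) _; set G' := \sum_(i < j) _.
ring.
Qed.



Theorem mainTheorem4 :
  exists B : nat -> nat -> {poly int},
    [/\ B_family B,
        forall B' : nat -> nat -> {poly int}, B_family B' ->
          forall j k : nat, (1 <= k <= j)%N -> B' j k = B j k
      & forall n : nat, (1 <= n)%N ->
          'X^n * poincare_fc (n - 1)
          = \sum_(1 <= i < n.+1) 'X^i
            - \sum_(2 <= k < n.+1) 'X^(n - k + 1) * B n k * poincare_fc (n - k)].
Proof.
exists triangle; split.
- exact: triangle_family.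
- by move=> B' B'_family; exact: B_family_uniq B'_family triangle_family.
move=> n n_gt0; have := triangle_nf_poly n 0.
rewrite big_ltn // (let: And3 B1 _ _ := triangle_family in B1 n n_gt0).
rewrite mul1r !add0n poincare_fcE subn1 prednK // => /(canRL (addrK _)) ->.
congr (_ - _).
  rewrite big_add1 big_mkord mulr_sumr; apply: eq_bigr => i _.
  by rewrite nf_poly0 mulr1 -exprD.
apply: eq_bigr => k _; rewrite poincare_fcE addn1 mulrA.
by congr (_ * _); exact: mulrC.
Qed.
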